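(* On undirected graphs, $\mathrm{sum}$-DHNs are strictly more expressive than $\mathrm{sum}$-GNNs with global readout and features enriched with homomorphism counts: every vertex property of undirected graphs expressible by such a GNN is expressible by a $\mathrm{sum}$-DHN, and there is a vertex property of undirected graphs that is expressible by a $\mathrm{sum}$-DHN but not by any such GNN. The same holds on directed graphs, and on graphs with constant input embedding $(0)$.
   Context: Graphs. A (directed) graph is a database over the schema $\{E\}$, $E$ binary, i.e. a finite set of facts $E(u,v)$, with vertex set $V(G)$; undirected graphs are those where $E$ is irreflexive and symmetric. A pointed graph $G^u$ is a graph with a vertex $u\in V(G)$. Pattern graphs $F$ may have isolated vertices. $\mathrm{Hom}(F^w,G^u)$ is the set of maps $h:V(F)\to V(G)$ with $h(w)=u$ that preserve $E$. DHNs. A sum-homomorphism query of input dimension $d\ge 0$ and output dimension $d'>0$ is a pair $(F^w,\mu)$, $F^w$ a pointed pattern graph, $\mu$ assigning to each $v\in V(F)$ a function $\mu_v:\mathbb R^d\to\mathbb R^{d'}$. On $G^u$ with embedding $\lambda:V(G)\to\mathbb R^d$ its result is $\sum_{h\in\mathrm{Hom}(F^w,G^u)}\prod_{v\in V(F)}\mu_v(\lambda(h(v)))$ (component-wise). A layer is a finite sequence of such queries of the same input dimension and a combination function $\mathrm{com}:\mathbb R^{d_1}\times\dots\times\mathbb R^{d_m}\to\mathbb R^{d'}$; it maps $\lambda$ to the embedding sending $u$ to $\mathrm{com}$ applied to the results of the queries on $(G^u,\lambda)$. A sum-DHN is a sequence $(\mathcal L_1,\dots,\mathcal L_k,\mathrm{cls})$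 of layers with matching dimensions and a classification function $\mathrm{cls}:\mathbb R^{d'}\to\{0,1\}$; starting from the input embedding (the empty-vector embedding, or, ''on graphs with constant embedding $(0)$'', the embedding assigning the one-dimensional vector $(0)$ to every vertex), apply the layers in order to get $\lambda^k$; $G^v$ is accepted iff $\mathrm{cls}(\lambda^k(v))=1$. All functions are arbitrary. GNNs with homomorphism counts. A sum-GNN with global readout and homomorphism counts from a finite tuple $(F_1^\bullet,\dots,F_n^\bullet)$ of pointed pattern graphs first assigns to each vertex $u$ of $G$ a feature vector computed from its input feature and the counts $|\mathrm{Hom}(F_i^\bullet,G^u)|$, $i=1,\dots,n$, and then applies finitely many message-passing layers, each replacing $\lambda$ by $\lambda'(u)=\mathrm{com}(\lambda(u),\sum_{w:E(u,w)\in G}\lambda(w))$, where in the last layer $\mathrm{com}$ additionally receives the global readout $\sum_{w\in V(G)}\lambda(w)$; finally a classification function is applied. Combination and classification functions are arbitrary. A classifier expresses the set of pointed graphs (of the class of graphs considered) that it accepts. *)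

(* Defs.v *)
From HB Require Import structures.
From mathcomp Require Import all_boot all_order all_algebra.
From mathcomp Require Import reals.

Set Implicit Arguments.
Unset Strict Implicit.
Unset Printing Implicit Defensive.

Import Order.TTheory GRing.Theory Num.Theory.
Local Open Scope ring_scope.

(* Loops and isolated vertices are allowed, both in data graphs and in
   pattern graphs. *)
Record graph := Graph { vertex :> finType; edge : rel vertex }.

Record pointed_graph := Pointed { pgraph :> graph; point : pgraph }.

Definition directed (G : graph) : Prop := True.

Definition undirected (G : graph) : Prop :=
  irreflexive (@edge G) /\ symmetric (@edge G).

Definition Hom (F G : pointed_graph) : {set {ffun F -> G}} :=
  [set h : {ffun F -> G} | (h (point F) == point G) &&
    [forall x, forall y, edge x y ==> edge (h x) (h y)]].

Definition embedding (R : realType) (G : graph) (d : nat) := G -> 'rV[R]_d.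

(* For d = 0 this is the empty-vector embedding, and for d = 1 the constant
   embedding (0). *)
Definition zero_embedding (R : realType) (d : nat) (G : graph) :
  embedding R G d := fun=> 0.

Section DHN.
Variable R : realType.

Record query (d d' : nat) := Query {
  query_dim_gt0 : (0 < d')%N;
  pattern : pointed_graph;
  query_fun : pattern -> 'rV[R]_d -> 'rV[R]_d' }.
Arguments query_fun {d d'} q _ _ : rename.

Definition query_result (d d' : nat) (q : query d d') (G : graph)
    (lam : embedding R G d) : embedding R G d' :=
  fun u => \sum_(h in Hom (pattern q) (Pointed u))
    \row_j \prod_(v : pattern q) query_fun q v (lam (h v)) 0 j.

Record dhn_layer (d d' : nat) := DHNLayer {
  layer_dim_gt0 : (0 < d')%N;
  arity : nat;
  query_dim : 'I_arity -> nat;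
  queries : forall i : 'I_arity, query d (query_dim i);
  dhn_com : {dffun forall i : 'I_arity, 'rV[R]_(query_dim i)} -> 'rV[R]_d' }.
Arguments dhn_com {d d'} L _ : rename.
Arguments queries {d d'} L i : rename.

Definition dhn_layer_eval (d d' : nat) (L : dhn_layer d d') (G : graph)
    (lam : embedding R G d) : embedding R G d' :=
  fun u => dhn_com L (finfun (fun i : 'I_(arity L) => query_result (queries L i) lam u)).

Inductive dhn (d : nat) : Type :=
| DHNClassify (cls : 'rV[R]_d -> bool)
| DHNThen (d' : nat) (L : dhn_layer d d') (N : dhn d').

Fixpoint dhn_eval (d : nat) (N : dhn d) (G : graph) :
    embedding R G d -> G -> bool :=
  match N with
  | DHNClassify cls => fun lam u => cls (lam u)
  | DHNThen _ L N' => fun lam => dhn_eval N' (dhn_layer_eval L lam)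
  end.

Definition dhn_accepts (d : nat) (N : dhn d) (G : pointed_graph) : bool :=
  dhn_eval N (@zero_embedding R d G) (point G).

End DHN.

Section GNN.
Variable R : realType.

Definition neighbour_sum (d : nat) (G : graph) (lam : embedding R G d) :
  embedding R G d := fun u => \sum_(w | edge u w) lam w.

Definition readout (d : nat) (G : graph) (lam : embedding R G d) : 'rV[R]_d :=
  \sum_w lam w.

(* A nonempty sequence of message-passing layers followed by a classification
   function. *)
Inductive mp_layers (d : nat) : Type :=
| MPLast (d' : nat) (com : 'rV[R]_d -> 'rV[R]_d -> 'rV[R]_d -> 'rV[R]_d')
    (cls : 'rV[R]_d' -> bool)
| MPThen (d' : nat) (com : 'rV[R]_d -> 'rV[R]_d -> 'rV[R]_d')
    (N : mp_layers d').

Fixpoint mp_eval (d : nat) (N : mp_layers d) (G : graph) :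
    embedding R G d -> G -> bool :=
  match N with
  | MPLast _ com cls => fun lam u =>
      cls (com (lam u) (neighbour_sum lam u) (readout lam))
  | MPThen _ com N' => fun lam =>
      mp_eval N' (fun u => com (lam u) (neighbour_sum lam u))
  end.

(* The case of no layer at all is kept apart, since only the last layer, if
   there is one, sees the readout. *)
Inductive gnn_body (d : nat) : Type :=
| GNNNoLayer (cls : 'rV[R]_d -> bool)
| GNNLayers (N : mp_layers d).

Definition gnn_body_eval (d : nat) (B : gnn_body d) (G : graph)
    (lam : embedding R G d) (u : G) : bool :=
  match B with
  | GNNNoLayer cls => cls (lam u)
  | GNNLayers N => mp_eval N lam u
  end.

Definition hom_counts (n : nat) (F : 'I_n -> pointed_graph) (G : graph) :
  embedding R G n := fun u => \row_i #|Hom (F i) (Pointed u)|%:R.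

Record hom_gnn (d : nat) := HomGNN {
  num_patterns : nat;
  patterns : 'I_num_patterns -> pointed_graph;
  feature_dim : nat;
  feature : 'rV[R]_d -> 'rV[R]_num_patterns -> 'rV[R]_feature_dim;
  body : gnn_body feature_dim }.
Arguments patterns {d} N _ : rename.
Arguments feature {d} N _ _ : rename.

Definition gnn_accepts (d : nat) (N : hom_gnn d) (G : pointed_graph) : bool :=
  gnn_body_eval (body N)
    (fun u => feature N (@zero_embedding R d G u)
                (hom_counts (patterns N) u))
    (point G).

End GNN.

Section Expressiveness.
Variables (R : realType) (C : graph -> Prop) (d : nat).

Definition expresses (accepts : pointed_graph -> bool)
    (P : pointed_graph -> Prop) : Prop :=
  forall G : pointed_graph, C G -> (accepts G <-> P G).

Definition dhn_expressible (P : pointed_graph -> Prop) : Prop :=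
  exists N : dhn R d, expresses (dhn_accepts N) P.

Definition gnn_expressible (P : pointed_graph -> Prop) : Prop :=
  exists N : hom_gnn R d, expresses (gnn_accepts N) P.

Definition dhn_strictly_more_expressive : Prop :=
  (forall P, gnn_expressible P -> dhn_expressible P) /\
  (exists P, dhn_expressible P /\ ~ gnn_expressible P).

End Expressiveness.

(* Main.v *)
(* Strictness is a diagonal argument over the countably many patterns.  For a
   set S of pairs let G_S be the double cover of a threshold graph on 'I_n
   whose edge between the fibres L_i and R_j is crossed iff (i, j) is in S.
   Exchanging the two sheets is an automorphism, and each vertex has exactly
   one neighbour in every adjacent fibre, so for a GNN the graph G_S only
   consists of its number of homomorphisms from each pattern at each of the n
   fibres.  There are 2 ^ Omega(n ^ 2) sets S but only 2 ^ O(n log n) values of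
   these counts when the patterns are fixed: for every k some G_S and G_S', of
   a size that determines k, agree on the first k patterns although S and S'
   differ at some pair (i_k, j_k).  The vertices over x have degree x, so a DHN
   can use degree and order to mark the fibres L_(i_k) and R_(j_k) in the k-th
   pair of graphs.  A triangle through a hub vertex and two marked vertices
   then exists iff the edge between these fibres is not crossed. *)

From mathcomp Require Import all_boot all_order all_algebra.
From mathcomp Require Import boolp reals zify.
Require Import Defs.

Set Implicit Arguments.
Unset Strict Implicit.
Unset Printing Implicit Defensive.

Import Order.TTheory GRing.Theory Num.Theory.
Local Open Scope ring_scope.

(** * Homomorphism counts under isomorphism *)

Lemma HomP (F G : pointed_graph) (h : {ffun F -> G}) :
  reflect (h (point F) = point G /\ forall x y : F, edge x y -> edge (h x) (h y))
          (h \in Hom F G).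
Proof.
rewrite inE; apply: (iffP andP) => -[/eqP hpt hE]; split=> //.
  by move=> x y; move/forallP/(_ x)/forallP/(_ y)/implyP: hE.
by apply/forallP=> x; apply/forallP=> y; apply/implyP; apply: hE.
Qed.

Lemma card_Hom_iso_pattern (F F' G : pointed_graph) (f : F -> F') :
  bijective f -> f (point F) = point F' ->
  (forall x y, edge (f x) (f y) = edge x y) -> #|Hom F G| = #|Hom F' G|.
Proof.
move=> [g fK gK] fpt fE.
pose r (h : {ffun F' -> G}) : {ffun F -> G} := [ffun x => h (f x)].
have r_inj : injective r.
  by move=> h h' /ffunP eqr; apply/ffunP=> y; have := eqr (g y); rewrite !ffunE gK.
rewrite -(card_imset _ r_inj); apply: eq_card => h.
apply/HomP/imsetP => [[hpt hE]|[h' /HomP[hpt hE] ->]].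
  exists [ffun y => h (g y)]; last by apply/ffunP=> x; rewrite !ffunE fK.
  apply/HomP; split=> [|x y]; rewrite !ffunE -?fpt ?fK // => xy.
  by apply: hE; rewrite -fE !gK.
by split=> [|x y xy]; rewrite !ffunE ?fpt //; apply: hE; rewrite fE.
Qed.

Lemma card_Hom_iso_target (F G G' : pointed_graph) (f : G -> G') :
  bijective f -> f (point G) = point G' ->
  (forall x y, edge (f x) (f y) = edge x y) -> #|Hom F G| = #|Hom F G'|.
Proof.
move=> [g fK gK] fpt fE.
pose r (h : {ffun F -> G}) : {ffun F -> G'} := [ffun x => f (h x)].
have r_inj : injective r.
  move=> h h' /ffunP eqr; apply/ffunP=> x.
  by have := eqr x; rewrite !ffunE => /(can_inj fK).
rewrite -(card_imset _ r_inj); apply: eq_card => h.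
apply/imsetP/HomP => [[h' /HomP[hpt hE] ->]|[hpt hE]].
  by split=> [|x y xy]; rewrite !ffunE ?hpt // fE; apply: hE.
exists [ffun x => g (h x)]; last by apply/ffunP=> x; rewrite !ffunE gK.
apply/HomP; split=> [|x y xy]; rewrite !ffunE ?hpt -?fpt ?fK //.
by rewrite -fE !gK; apply: hE.
Qed.

(** * Queries for counts, own features, neighbour sums and readout *)

Section Queries.
Variables (R : realType) (d : nat).

Definition count_query (F : pointed_graph) : query R d 1 :=
  @Query R d 1 isT F (fun _ _ => const_mx 1).

Lemma count_queryE (F : pointed_graph) (G : graph) (lam : embedding R G d) u :
  query_result (count_query F) lam u = const_mx #|Hom F (Pointed u)|%:R.
Proof.
apply/rowP=> j; rewrite summxE mxE.
under eq_bigr => h _.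
  rewrite mxE big1 => [|v _]; last by rewrite mxE.
  over.
by rewrite sumr_const.
Qed.

Definition point_pattern : pointed_graph :=
  @Pointed (@Graph unit (fun _ _ => false)) tt.

(** When [adjacent] is false, the vertex [true] is isolated and ranges over the whole graph, so one
    query shape yields both neighbour sum and readout. *)
Definition pair_pattern (adjacent : bool) : pointed_graph :=
  @Pointed (@Graph bool (fun x y => [&& adjacent, ~~ x & y])) false.

Section Positive.
Variables (d' : nat) (d'_gt0 : (0 < d')%N) (f : 'rV[R]_d -> 'rV[R]_d').

Definition point_query : query R d d' :=
  @Query R d d' d'_gt0 point_pattern (fun=> f).

Lemma point_queryE (G : graph) (lam : embedding R G d) u :
  query_result point_query lam u = f (lam u).
Proof.
rewrite /query_result (big_pred1 [ffun=> u]).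
  by apply/rowP=> j; rewrite mxE /= (bigD1 tt) //= ffunE big1 ?mulr1 // => -[].
move=> h; apply/(@HomP point_pattern (Pointed u))/eqP => [[/= hpt _]|->].
  by apply/ffunP=> -[]; rewrite ffunE.
by split; rewrite ?ffunE.
Qed.

Definition pair_query (adjacent : bool) : query R d d' :=
  @Query R d d' d'_gt0 (pair_pattern adjacent)
    (fun v x => if v then f x else const_mx 1).

Lemma pair_queryE adjacent (G : graph) (lam : embedding R G d) u :
  query_result (pair_query adjacent) lam u =
  \sum_(w | adjacent ==> edge u w) f (lam w).
Proof.
rewrite /query_result.
rewrite (reindex_onto (fun w => [ffun b : pair_pattern adjacent => if b then w else u])
  (fun h => h true)) /=; last first.
  by move=> h /(@HomP (pair_pattern adjacent) (Pointed u))[/= hpt _];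
    apply/ffunP=> -[]; rewrite ffunE.
apply: eq_big => [w|w _].
  rewrite ffunE eqxx andbT.
  apply/(@HomP (pair_pattern adjacent) (Pointed u))/implyP => /= [[_ hE] adj|hE].
    by have := hE false true; rewrite !ffunE adj; apply.
  by split=> [|x y]; rewrite !ffunE // => /and3P[adj /negbTE-> ->]; apply: hE.
apply/rowP=> j; rewrite mxE /= (bigD1 true) //= (bigD1 false) //=.
by rewrite !ffunE mxE mul1r big1 ?mulr1 // => -[].
Qed.

End Positive.
End Queries.

(** * Simulation of GNNs by DHNs, layer by layer *)

Section UniformLayer.
Variables (R : realType) (d d' e m : nat).
Variables (q : 'I_m -> query R d e) (com : ('I_m -> 'rV[R]_e) -> 'rV[R]_d'.+1).

Definition uniform_layer : dhn_layer R d d'.+1 :=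
  @DHNLayer R d d'.+1 isT m (fun=> e) q (fun r => com (fun i => r i)).

Lemma uniform_layerE (G : graph) (lam : embedding R G d) u :
  dhn_layer_eval uniform_layer lam u = com (fun i => query_result (q i) lam u).
Proof. by congr com; apply/funext=> i; rewrite ffunE. Qed.

End UniformLayer.

Section Simulation.
Variable R : realType.

(* GNN features may have dimension 0, DHN layers may not: one dummy
   coordinate is added. *)
Definition pad d (x : 'rV[R]_d) : 'rV[R]_(1 + d) := row_mx 0 x.
Definition unpad d (x : 'rV[R]_(1 + d)) : 'rV[R]_d := rsubmx x.

Lemma padK d : cancel (@pad d) (@unpad d).
Proof. by move=> x; rewrite /unpad row_mxKr. Qed.

Lemma unpad_sum d (I : finType) (P : pred I) (F : I -> 'rV[R]_d) :
  unpad (\sum_(i | P i) pad (F i)) = \sum_(i | P i) F i.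
Proof. by rewrite /unpad raddf_sum; apply: eq_bigr => i _; apply: padK. Qed.

(** A layer without readout is the case of a [com] constant in its third argument, so one
    construction covers both kinds of layer. *)
Definition mp_dhn_layer d d'
    (com : 'rV[R]_d -> 'rV[R]_d -> 'rV[R]_d -> 'rV[R]_d') :
    dhn_layer R (1 + d) (1 + d') :=
  uniform_layer
    (fun i : 'I_3 => if i == 0 then point_query (ltn0Sn d) id
                     else pair_query (ltn0Sn d) id (i == 1))
    (fun r : 'I_3 -> 'rV_(1 + d) =>
       pad (com (unpad (r 0)) (unpad (r 1)) (unpad (r 2%:R)))).

Lemma mp_dhn_layerE d d' com (G : graph) (lam : embedding R G d) :
  dhn_layer_eval (@mp_dhn_layer d d' com) (fun u => pad (lam u)) =
  (fun u => pad (com (lam u) (neighbour_sum lam u) (readout lam))).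
Proof.
apply/funext=> u; rewrite uniform_layerE /=.
by rewrite point_queryE !pair_queryE /= padK !unpad_sum.
Qed.

Fixpoint dhn_of_mp d (N : mp_layers R d) : dhn R (1 + d) :=
  match N with
  | MPLast _ com cls =>
      DHNThen (mp_dhn_layer com) (DHNClassify (fun x => cls (unpad x)))
  | MPThen _ com N' =>
      DHNThen (mp_dhn_layer (fun x s _ => com x s)) (dhn_of_mp N')
  end.

Lemma dhn_of_mpE d (N : mp_layers R d) (G : graph) (lam : embedding R G d) :
  dhn_eval (dhn_of_mp N) (fun u => pad (lam u)) = mp_eval N lam.
Proof.
elim: N lam => [d1 d' com cls|d1 d' com N' IH] lam.
  rewrite -[LHS]/(cls \o @unpad _ \o dhn_layer_eval (mp_dhn_layer com) _).
  by rewrite mp_dhn_layerE; apply/funext=> u; rewrite /= padK.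
rewrite -[LHS]/(dhn_eval (dhn_of_mp N') (dhn_layer_eval (mp_dhn_layer _) _)).
by rewrite mp_dhn_layerE; apply: IH.
Qed.

Definition dhn_of_body d (B : gnn_body R d) : dhn R (1 + d) :=
  match B with
  | GNNNoLayer cls => DHNClassify (fun x => cls (unpad x))
  | GNNLayers N => dhn_of_mp N
  end.

Lemma dhn_of_bodyE d (B : gnn_body R d) (G : graph) (lam : embedding R G d) :
  dhn_eval (dhn_of_body B) (fun u => pad (lam u)) = gnn_body_eval B lam.
Proof.
case: B => [cls|N] /=; last exact: dhn_of_mpE.
by apply/funext=> u; rewrite padK.
Qed.

(** The input embedding is identically zero, hence the constant [0] in place of the input
    feature. *)
Definition dhn_of_gnn d (N : hom_gnn R d) : dhn R d :=
  DHNThen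
    (uniform_layer (fun i => count_query R d (@patterns R d N i))
       (fun r => pad (@feature R d N 0 (\row_i r i 0 0))))
    (dhn_of_body (body N)).

Lemma dhn_of_gnnE d (N : hom_gnn R d) (G : pointed_graph) :
  dhn_accepts (dhn_of_gnn N) G = gnn_accepts N G.
Proof.
rewrite /dhn_accepts /gnn_accepts /= -dhn_of_bodyE; congr (dhn_eval _ _ _).
apply/funext=> u; rewrite uniform_layerE; congr (pad (feature _ _)).
by apply/rowP=> i; rewrite !mxE count_queryE mxE.
Qed.

Lemma dhn_expressible_of_gnn (C : graph -> Prop) d (P : pointed_graph -> Prop) :
  gnn_expressible R C d P -> dhn_expressible R C d P.
Proof.
by case=> N NP; exists (dhn_of_gnn N) => G CG; rewrite dhn_of_gnnE; apply: NP.
Qed.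

End Simulation.

(** * Double covers and their indistinguishability for GNNs *)

Section DoubleCover.
Variable n : nat.
Implicit Types tw : rel 'I_n.

(* Base graph: x and y are adjacent iff x + y >= n, so x has degree x when the
   loops at 2x >= n are counted; a loop lifts to an edge between the sheets as
   soon as tw is reflexive. *)
Definition double_cover tw : graph :=
  @Graph ('I_n * bool)%type
    (fun u v => (n <= u.1 + v.1)%N && (u.2 (+) v.2 == tw u.1 v.1)).

Lemma double_cover_undirected tw :
  reflexive tw -> symmetric tw -> undirected (double_cover tw).
Proof.
move=> tw_refl tw_sym; split=> [u|u v] /=; first by rewrite tw_refl addbb andbF.
by rewrite addnC addbC tw_sym.
Qed.

(* Every vertex over x has exactly one neighbour over each y with x + y >= n:
   colour refinement does not see the twist. *)
Lemma double_cover_sum_edge (V : nmodType) tw (f : 'I_n -> V) (u : double_cover tw) :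
  \sum_(w | edge u w) f w.1 = \sum_(y : 'I_n | (n <= u.1 + y)%N) f y.
Proof.
transitivity (\sum_(y : 'I_n | (n <= u.1 + y)%N)
    \sum_(c | c == u.2 (+) tw u.1 y) f y).
  rewrite pair_big_dep; apply: eq_bigl => -[y c] /=.
  by case: u => x [] /=; case: c; case: (tw x y).
by apply: eq_bigr => y _; rewrite big_pred1_eq.
Qed.

Lemma double_cover_degree (R : nzSemiRingType) tw (u : double_cover tw) :
  \sum_(w | edge u w) (1 : R) = (val u.1)%:R.
Proof.
rewrite (double_cover_sum_edge (fun=> 1)) sumr_const; congr (_%:R).
case: u => x _ /=.
transitivity #|[pred y : 'I_n | (y < x)%N]|.
  (* Reversal, [y] to [n - 1 - y], turns [n <= x + y] into [y < x]. *)
  rewrite -(card_imset _ (@rev_ord_inj n)); apply: eq_card => y.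
  rewrite [RHS]inE /=; apply/imsetP/idP => [[z]|yx].
    by rewrite unfold_in => /= zP ->; have /= := ltn_ord z; lia.
  exists (rev_ord y); last by rewrite rev_ordK.
  by rewrite unfold_in /=; have := ltn_ord y; lia.
by rewrite -sum1_card -(big_ord_widen n (fun=> 1%N)) 1?ltnW // sum_nat_const card_ord muln1.
Qed.

Lemma double_cover_card tw : #|double_cover tw| = n.*2.
Proof. by rewrite card_prod card_ord card_bool muln2. Qed.

(** Edges see the sheets only through [u.2 (+) v.2], which is unchanged when both are negated. *)
Lemma card_Hom_swap (F : pointed_graph) tw (x : 'I_n) a b :
  #|Hom F (Pointed ((x, a) : double_cover tw))| =
  #|Hom F (Pointed ((x, b) : double_cover tw))|.
Proof.
have [->//|neq_ab] := eqVneq a b.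
pose swap (u : double_cover tw) : double_cover tw := (u.1, ~~ u.2).
have swapK : involutive swap by move=> [y c]; rewrite /swap /= negbK.
apply: (@card_Hom_iso_target F (@Pointed (double_cover tw) (x, a))
  (@Pointed (double_cover tw) (x, b)) swap) => //=.
- exact: (Bijective swapK swapK).
- by rewrite /swap /=; case: a b neq_ab => [] [].
by move=> [y c] [z e] /=; rewrite addNb addbN negbK.
Qed.

Section Indistinguishable.
Variables (R : realType) (tw tw' : rel 'I_n).

(** The embedding remains a function of the fibre through every layer; the readouts agree because
    both covers have the same vertices. *)
Lemma mp_eval_double_cover d (N : mp_layers R d) (lam : 'I_n -> 'rV[R]_d) u :
  @mp_eval R d N (double_cover tw) (fun v => lam v.1) u =
  @mp_eval R d N (double_cover tw') (fun v => lam v.1) u.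
Proof.
elim: N lam => [d1 d' com cls|d1 d' com N' IH] lam /=.
  by rewrite /neighbour_sum !double_cover_sum_edge.
under eq_fun do rewrite /neighbour_sum double_cover_sum_edge.
rewrite (IH (fun x => com (lam x) (\sum_(y : 'I_n | (n <= x + y)%N) lam y))).
by congr (mp_eval _ _ _); apply/funext=> v; rewrite /neighbour_sum double_cover_sum_edge.
Qed.

Lemma gnn_body_eval_double_cover d (B : gnn_body R d) (lam : 'I_n -> 'rV[R]_d) u :
  @gnn_body_eval R d B (double_cover tw) (fun v => lam v.1) u =
  @gnn_body_eval R d B (double_cover tw') (fun v => lam v.1) u.
Proof. by case: B => [//|N]; apply: mp_eval_double_cover. Qed.

End Indistinguishable.

(** Brings the initial features into the form [lam v.1] on which the two covers can be compared. *)
Lemma gnn_accepts_count (R : realType) d (N : hom_gnn R d) tw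
    (cnt : 'I_(num_patterns N) -> 'I_n -> nat) (u : double_cover tw) :
  (forall i x, #|Hom (@patterns R d N i) (Pointed ((x, false) : double_cover tw))|
               = cnt i x) ->
  gnn_accepts N (Pointed u) =
  @gnn_body_eval R _ (body N) (double_cover tw)
    (fun v => @feature R d N 0 (\row_i (cnt i v.1)%:R)) u.
Proof.
move=> cntE; rewrite /gnn_accepts; congr (gnn_body_eval _ _ _).
apply/funext=> -[x a]; congr (feature _ _); apply/rowP=> i.
by rewrite !mxE (card_Hom_swap _ _ _ a false) cntE.
Qed.

Lemma gnn_accepts_double_cover (R : realType) d (N : hom_gnn R d) tw tw' u :
  (forall i x, #|Hom (@patterns R d N i) (Pointed ((x, false) : double_cover tw))| =
               #|Hom (@patterns R d N i) (Pointed ((x, false) : double_cover tw'))|) ->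
  gnn_accepts N (Pointed (u : double_cover tw)) =
  gnn_accepts N (Pointed (u : double_cover tw')).
Proof.
move=> eq_count; pose cnt i (x : 'I_n) :=
  #|Hom (@patterns R d N i) (Pointed ((x, false) : double_cover tw'))|.
rewrite (@gnn_accepts_count R d N tw cnt u eq_count).
rewrite (@gnn_accepts_count R d N tw' cnt u (fun _ _ => erefl)).
exact: (gnn_body_eval_double_cover tw' (body N)
  (fun x => @feature R d N 0 (\row_i (cnt i x)%:R))).
Qed.

End DoubleCover.

(** * Twists given by sets of pairs, and the hub *)

Section Twist.
Variable p : nat.
Local Notation n := (4 * p + 2)%N.
Implicit Types S : {set 'I_p * 'I_p}.

(* The upper half of 'I_n is a clique: 2p+1+i and 3p+1+j are L_i and R_j, and
   4p+1 is the hub. *)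
Fact left_subproof (i : 'I_p) : (2 * p + 1 + i < n)%N.
Proof. by have := ltn_ord i; lia. Qed.
Fact right_subproof (i : 'I_p) : (3 * p + 1 + i < n)%N.
Proof. by have := ltn_ord i; lia. Qed.
Fact hub_subproof : (4 * p + 1 < n)%N.
Proof. by rewrite addn2 addn1. Qed.

Definition left_vertex i := Ordinal (left_subproof i).
Definition right_vertex i := Ordinal (right_subproof i).
Definition hub := Ordinal hub_subproof.

Definition half_twist S : rel 'I_n := fun x y =>
  [exists ij in S, (x == left_vertex ij.1) && (y == right_vertex ij.2)].

Definition twist S : rel 'I_n := fun x y =>
  [|| x == y, half_twist S x y | half_twist S y x].

Definition cover S : graph := double_cover (twist S).

Lemma twist_refl S : reflexive (twist S).
Proof. by move=> x; rewrite /twist eqxx. Qed.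

Lemma twist_sym S : symmetric (twist S).
Proof. by move=> x y; rewrite /twist eq_sym; congr (_ || _); rewrite orbC. Qed.

Lemma cover_undirected S : undirected (cover S).
Proof. exact: double_cover_undirected (twist_refl S) (@twist_sym S). Qed.

Lemma left_right i j : (left_vertex i == right_vertex j) = false.
Proof. by apply/eqP=> /(congr1 val) /=; have := ltn_ord i; lia. Qed.

Lemma left_inj : injective left_vertex.
Proof. by move=> i j /(congr1 val) /= ?; apply: val_inj => /=; lia. Qed.

Lemma right_inj : injective right_vertex.
Proof. by move=> i j /(congr1 val) /= ?; apply: val_inj => /=; lia. Qed.

Lemma twist_left_right S i j : twist S (left_vertex i) (right_vertex j) = ((i, j) \in S).
Proof.
rewrite /twist left_right /=; apply/orP/idP => [[]|ijS].
- by case/exists_inP=> -[i' j'] S_ij /= /andP[/eqP/left_inj-> /eqP/right_inj->].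
- by case/exists_inP=> -[i' j'] _ /= /andP[]; rewrite eq_sym left_right.
by left; apply/exists_inP; exists (i, j) => //=; rewrite !eqxx.
Qed.

Lemma left_hub i : (left_vertex i == hub) = false.
Proof. by apply/eqP=> /(congr1 val) /=; have := ltn_ord i; lia. Qed.

Lemma right_hub i : (right_vertex i == hub) = false.
Proof. by apply/eqP=> /(congr1 val) /=; have := ltn_ord i; lia. Qed.

(** Outside its own fibre the hub has neighbours on its own sheet only, so a triangle through it
    reveals the twist between the other two fibres. *)
Lemma twist_hub S x : twist S hub x = (x == hub).
Proof.
rewrite /twist eq_sym; case: eqP => //= _.
apply/norP; split; apply/exists_inP=> -[[i j] _ /=].
  by rewrite eq_sym left_hub.
by rewrite [hub == _]eq_sym right_hub andbF.
Qed.

End Twist.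

(** * Enumeration of patterns and the pigeonhole count *)

Section PatternEnumeration.
Local Open Scope nat_scope.

(** Up to isomorphism the vertex set is some ['I_s]; these codes form a countable type, numbered by
    [pickle]. *)
Definition pattern_code := {s : nat & ({ffun 'I_s * 'I_s -> bool} * 'I_s)%type}.

Definition pattern_of_code (c : pattern_code) : pointed_graph :=
  @Pointed (@Graph 'I_(tag c) (fun x y => (tagged c).1 (x, y))) (tagged c).2.

Definition one_vertex_code : pattern_code :=
  existT _ 1 ([ffun=> false], ord0).

Definition nth_pattern (t : nat) : pointed_graph :=
  pattern_of_code (odflt one_vertex_code (unpickle t)).

Lemma nth_pattern_surj (F : pointed_graph) :
  exists t, forall G, #|Hom (nth_pattern t) G| = #|Hom F G|.
Proof.
pose c : pattern_code := existT _ #|F|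
  ([ffun xy => edge (enum_val xy.1) (enum_val xy.2)], enum_rank (point F)).
exists (pickle c) => G; rewrite /nth_pattern pickleK.
apply: (@card_Hom_iso_pattern (pattern_of_code c) F G (fun x => enum_val x)) => /=.
- exact: enum_val_bij.
- exact: enum_rankK.
- by move=> x y; rewrite ffunE.
Qed.

Definition pattern_size (k : nat) : nat := \sum_(t < k) #|nth_pattern t|.

Lemma card_Hom_le (t k : nat) (G : pointed_graph) :
  (t < k)%N -> (#|Hom (nth_pattern t) G| <= #|G| ^ pattern_size k)%N.
Proof.
move=> lt_tk; apply: leq_trans (max_card _) _; rewrite card_ffun.
rewrite leq_pexp2l //; first by apply/card_gt0P; exists (point G).
by rewrite /pattern_size (bigD1 (Ordinal lt_tk)) //= leq_addr.
Qed.

(* With A the inner product, 2 ^ (2 A + 8) exceeds A * (2 A + 12), which is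
   what the pigeonhole principle needs. *)
Definition cover_param (k : nat) : nat :=
  2 ^ (2 * (6 * (pattern_size k).+1 * k) + 8).

(** Through injectivity the order of a cover determines its stage [k]. *)
Lemma cover_param_inj : injective cover_param.
Proof.
have lt_param : {homo cover_param : k k' / (k < k')%N}.
  apply: homo_ltn ltn_trans _ => k; rewrite /cover_param ltn_exp2l // ltn_add2r.
  by rewrite /pattern_size big_ord_recr /=; nia.
move=> k k' eq_kk'; case: (ltngtP k k') => // /lt_param; rewrite eq_kk' ltnn //.
Qed.

(** The left side counts profiles, with one bounded number for each of [k] patterns and [4 * p + 2]
    fibres; the right side counts subsets of ['I_p * 'I_p]. *)
Lemma pigeonhole_bound (k : nat) (p := cover_param k) :
  (((4 * p + 2).*2 ^ pattern_size k).+1 ^ (k * (4 * p + 2)) < 2 ^ (p * p))%N.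
Proof.
rewrite /p /cover_param; set M := pattern_size k; set A := (6 * M.+1 * k)%N.
set q := (2 * A + 8)%N; set P := (2 ^ q)%N.
have P_gt0 : (0 < P)%N by rewrite expn_gt0.
have P_large : (A * (q + 4) < P)%N.
  have A_lt : (A < 2 ^ A)%N by apply: ltn_expl.
  have -> : P = (256 * (2 ^ A * 2 ^ A))%N.
    by rewrite /P /q expnD mulnC mul2n -addnn expnD.
  rewrite /q; move: (2 ^ A)%N A_lt => B; nia.
have size_le : ((4 * P + 2).*2 <= 2 ^ (q + 4))%N.
  by rewrite expnD -/P (_ : 2 ^ 4 = 16)%N //; lia.
have count_le : (((4 * P + 2).*2 ^ M).+1 <= 2 ^ ((q + 4) * M.+1))%N.
  rewrite mulnSr expnD expnM.
  have : ((4 * P + 2).*2 ^ M <= (2 ^ (q + 4)) ^ M)%N by case: (M) => // m; rewrite leq_exp2r.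
  have : (0 < (2 ^ (q + 4)) ^ M)%N by rewrite !expn_gt0.
  have : (2 <= 2 ^ (q + 4))%N by rewrite addn4 expnS; have := expn_gt0 2 q.+3; lia.
  nia.
apply: (@leq_ltn_trans ((2 ^ ((q + 4) * M.+1)) ^ (k * (4 * P + 2)))).
  by case: (k * _)%N => // m; rewrite leq_exp2r.
rewrite -expnM ltn_exp2l //.
(* The factor 6 in [A] comes from [4 * P + 2 <= 6 * P]. *)
apply: (@leq_ltn_trans (A * (q + 4) * P)); last by rewrite ltn_pmul2r.
rewrite /A; nia.
Qed.

Lemma set_neq_mem (T : finType) (A B : {set T}) : A != B ->
  exists x, (x \in A /\ x \notin B) \/ (x \in B /\ x \notin A).
Proof.
rewrite eqEsubset negb_and => /orP[] /subsetPn[x xA xB]; exists x; by [left|right].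
Qed.

(** Two sets with the same profile exist by pigeonhole. They are packed with a separating pair into
    one tuple, so that a single choice over [k] selects everything. *)
Lemma cover_collision (k p : nat) :
  ((4 * p + 2).*2 ^ pattern_size k).+1 ^ (k * (4 * p + 2)) < 2 ^ (p * p) ->
  exists D : {set 'I_p * 'I_p} * {set 'I_p * 'I_p} * ('I_p * 'I_p),
  [/\ D.2 \in D.1.1, D.2 \notin D.1.2 &
   forall t x, (t < k)%N ->
     #|Hom (nth_pattern t) (Pointed ((x, false) : cover D.1.1))| =
     #|Hom (nth_pattern t) (Pointed ((x, false) : cover D.1.2))|].
Proof.
move=> lt_bound; pose bound := (#|{: 'I_(4 * p + 2) * bool}| ^ pattern_size k)%N.
(* [inord] loses nothing, since [card_Hom_le] keeps every count within [bound]. *)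
pose profile (S : {set 'I_p * 'I_p}) : {ffun 'I_k * 'I_(4 * p + 2) -> 'I_bound.+1} :=
  [ffun tx : 'I_k * 'I_(4 * p + 2) => inord #|Hom (nth_pattern tx.1) (Pointed ((tx.2, false) : cover S))|].
have /injectivePn[S [S' neqSS' eqSS']] : ~~ injectiveb profile.
  apply/negP=> /injectiveP/leq_card; rewrite leqNgt => /negP; apply.
  have -> : #|{set 'I_p * 'I_p}| = 2 ^ (p * p).
    by rewrite -cardsT -powersetT card_powerset cardsT card_prod card_ord.
  rewrite card_ffun card_ord /bound !card_prod card_bool !card_ord muln2.
  exact: lt_bound.
clear lt_bound.
have eq_count t x : (t < k)%N ->
    #|Hom (nth_pattern t) (Pointed ((x, false) : cover S))| =
    #|Hom (nth_pattern t) (Pointed ((x, false) : cover S'))|.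
  move=> lt_tk.
  have profileE T : nat_of_ord (profile T (Ordinal lt_tk, x)) =
      #|Hom (nth_pattern t) (Pointed ((x, false) : cover T))|.
    rewrite ffunE inordK; first by [].
    rewrite ltnS; exact: (@card_Hom_le t k (@Pointed (cover T) (x, false))).
  apply: etrans (esym (profileE S)) (etrans _ (profileE S')).
  by rewrite eqSS'.
have [ij [[ijS ijS']|[ijS' ijS]]] := set_neq_mem neqSS'.
  exists (S, S', ij); split; [exact: ijS|exact: ijS'|exact: eq_count].
exists (S', S, ij); split; [exact: ijS'|exact: ijS|].
move=> t x lt_tk; exact: esym (eq_count t x lt_tk).
Qed.

End PatternEnumeration.

(** * A DHN detecting triangles with two marked vertices *)

Section TriangleDHN.
Variables (R : realType) (special : R -> R -> bool).

Definition triangle_pattern : pointed_graph :=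
  @Pointed (@Graph 'I_3 (fun x y => (x < y)%N)) 0.

Definition triangle_query : query R 1 1 :=
  @Query R 1 1 isT triangle_pattern (fun v x => if v == 0 then const_mx 1 else x).

Definition degree (G : graph) (u : G) : R := \sum_(w | edge u w) 1.

(** Queries 0 and 1 of the first layer give the degree and the order, from which [special] computes
    a 0/1 mark. *)
Definition triangle_dhn d : dhn R d :=
  DHNThen
    (uniform_layer
       (fun i : 'I_2 => pair_query (ltn0Sn 0) (fun _ : 'rV[R]_d => const_mx 1) (i == 0))
       (fun r => const_mx (special (r 0 0 0) (r 1 0 0))%:R))
    (DHNThen (uniform_layer (fun _ : 'I_1 => triangle_query) (fun r => r 0))
       (DHNClassify (fun x => x 0 0 != 0))).

(** Every homomorphism contributes 0 or 1, so nothing cancels and the sum is nonzero iff some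
    contribution is 1. *)
Lemma triangle_dhnP d (G : graph) (u : G) :
  reflect (exists x y : G, [/\ edge u x, edge u y, edge x y,
             special (degree x) #|G|%:R & special (degree y) #|G|%:R])
          (dhn_accepts (triangle_dhn d) (Pointed u)).
Proof.
pose mark (x : G) := special (degree x) #|G|%:R.
pose lam : embedding R G 1 := dhn_layer_eval
  (uniform_layer
     (fun i : 'I_2 => pair_query (ltn0Sn 0) (fun _ : 'rV[R]_d => const_mx 1) (i == 0))
     (fun r => const_mx (special (r 0 0 0) (r 1 0 0))%:R)) (@zero_embedding R d G).
have -> : dhn_accepts (triangle_dhn d) (Pointed u) =
    (query_result triangle_query lam u 0 0 != 0).
  by rewrite -(uniform_layerE (fun _ : 'I_1 => triangle_query) (fun r => r 0)).
have lamE x : lam x = const_mx (mark x)%:R.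
  have sum1E (P : pred G) : (\sum_(w | P w) (const_mx 1 : 'rV[R]_1)) 0 0 = \sum_(w | P w) 1.
    by rewrite summxE; apply: eq_bigr => w _; rewrite mxE.
  by rewrite /lam uniform_layerE !pair_queryE /= !sum1E [X in special _ X]sumr_const.
rewrite /query_result summxE psumr_neq0 => [|h _]; last first.
  rewrite mxE prodr_ge0 // => v _ /=.
  by case: (v == 0); rewrite ?lamE mxE ?ler01 ?ler0n.
have prodE (h : {ffun triangle_pattern -> G}) :
    (\row_j \prod_(v : triangle_pattern) @query_fun R 1 1 triangle_query v (lam (h v)) 0 j) 0 0
      = (mark (h (1 : 'I_3)) && mark (h (2%:R : 'I_3)))%:R.
  rewrite mxE /= !big_ord_recl big_ord0 /= !lamE !mxE mul1r mulr1 -natrM mulnb.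
  by congr ((mark (h _) && mark (h _))%:R); apply: val_inj.
apply: (iffP hasP) => [[h _ /andP[h_hom]]|[x [y [ux uy xy sx sy]]]].
  rewrite prodE ltr0n lt0b => /andP[mark1 mark2].
  have [/= h0 hE] := @HomP triangle_pattern (Pointed u) h h_hom.
  by exists (h (1 : 'I_3)), (h (2%:R : 'I_3)); split=> //; rewrite -?h0; apply: hE.
pose h : {ffun triangle_pattern -> G} :=
  [ffun v : 'I_3 => if v == 0 then u else if v == 1 then x else y].
exists h; first exact: mem_index_enum.
rewrite prodE !ffunE /= {1}/mark sx {1}/mark sy ltr01 andbT.
apply/(@HomP triangle_pattern (Pointed u)); split; first by rewrite ffunE.
by move=> [[|[|[|//]]] v_lt] [[|[|[|//]]] w_lt]; rewrite !ffunE.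
Qed.

End TriangleDHN.

Section Hub.
Variables (R : realType) (special : R -> R -> bool) (p : nat).
Local Notation n := (4 * p + 2)%N.
Variables (S : {set 'I_p * 'I_p}) (i j : 'I_p).
Hypothesis specialE : forall x : 'I_n,
  special (val x)%:R n.*2%:R = (x == left_vertex i) || (x == right_vertex j).

(** Both marked vertices of a triangle lie on the sheet of the hub. Reflexivity of the twist rules
    out a common fibre, so they join [left_vertex i] to [right_vertex j] without crossing. *)
Lemma triangle_dhn_hub d :
  dhn_accepts (triangle_dhn special d) (Pointed ((hub p, false) : cover S)) =
  ((i, j) \notin S).
Proof.
have specialE' (x : cover S) : special (degree R x) #|cover S|%:R =
    (x.1 == left_vertex i) || (x.1 == right_vertex j).
  by rewrite /degree double_cover_degree double_cover_card specialE.
have neq_hub (x : 'I_n) : (x == left_vertex i) || (x == right_vertex j) ->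
    (x == hub p) = false.
  by case/orP=> /eqP->; rewrite ?left_hub ?right_hub.
apply/triangle_dhnP/idP => [[[x a] [[y c] []]]|ijS].
  rewrite !specialE' /= !twist_hub => /andP[_ hx] /andP[_ hy] /andP[_ hxy] sx sy.
  move: hx hy hxy; rewrite (neq_hub x sx) (neq_hub y sy) /=.
  case: a; case: c => //= _ _; rewrite eq_sym eqbF_neg; rewrite -(twist_left_right S).
  by case/orP: sx => /eqP->; case/orP: sy => /eqP->; rewrite ?twist_refl // twist_sym.
exists (left_vertex i, false), (right_vertex j, false).
rewrite !specialE' /= !twist_hub left_hub right_hub twist_left_right (negbTE ijS).
by rewrite !eqxx orbT /= !andbT; have := ltn_ord i; split=> //; lia.
Qed.

End Hub.

(** * Diagonalisation over all finite tuples of patterns *)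

(** The dependent form is required because the sets chosen at stage [k] live over ['I_(p k)]. *)
Lemma dependent_choice (I : Type) (T : I -> Type) (P : forall i, T i -> Prop) :
  (forall i, exists x, P i x) -> exists f, forall i, P i (f i).
Proof.
move=> exP; exists (fun i => projT1 (cid (exP i))) => i.
exact: projT2 (cid (exP i)).
Qed.

Lemma cover_collisions : exists2 p : nat -> nat, injective p & forall k,
  exists D : {set 'I_(p k) * 'I_(p k)} * {set 'I_(p k) * 'I_(p k)} *
             ('I_(p k) * 'I_(p k)),
  [/\ D.2 \in D.1.1, D.2 \notin D.1.2 &
   forall t x, (t < k)%N ->
     #|Hom (nth_pattern t) (Pointed ((x, false) : cover D.1.1))| =
     #|Hom (nth_pattern t) (Pointed ((x, false) : cover D.1.2))|].
Proof.
exists cover_param => [|k]; first exact: cover_param_inj.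
exact: cover_collision (@pigeonhole_bound k).
Qed.

(** The separating covers are undirected, so one DHN serves every class containing the undirected
    graphs. *)
Lemma dhn_not_gnn (R : realType) d :
  exists N : dhn R d, forall C : graph -> Prop,
    (forall G, undirected G -> C G) -> ~ gnn_expressible R C d (dhn_accepts N).
Proof.
have [p p_inj collisions] := cover_collisions.
have [D DP] := dependent_choice collisions.
(* The order [b] selects the stage, and the degree [a] then singles out the two fibres of the
   separating pair. *)
pose special (a b : R) := `[< exists k, b = (4 * p k + 2).*2%:R /\
  (a = (val (left_vertex (D k).2.1))%:R \/ a = (val (right_vertex (D k).2.2))%:R) >].
have specialE k (x : 'I_(4 * p k + 2)) :
    special (val x)%:R (4 * p k + 2).*2%:R =
    (x == left_vertex (D k).2.1) || (x == right_vertex (D k).2.2).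
  apply/asboolP/orP => [[k' [/eqP]]|].
    rewrite eqr_nat => /eqP eq_size.
    have /p_inj <- : p k = p k' by lia.
    by case=> /eqP; rewrite eqr_nat => x_eq; [left|right].
  by case=> /eqP->; exists k; split=> //; [left|right].
exists (triangle_dhn special d) => C undirC [N NP].
have [t tP] := choice (fun i => nth_pattern_surj (@patterns R d N i)).
(* Stage [k] lies beyond the indices of all patterns of the GNN, so the two covers agree on all its
   counts. *)
pose k := (\max_i t i).+1; have lt_tk i : (t i < k)%N by rewrite ltnS leq_bigmax.
have [ijS ijS' eq_count] := DP k.
move: (D k).1.1 (D k).1.2 ijS ijS' eq_count => S S' ijS ijS' eq_count.
pose u : 'I_(4 * p k + 2) * bool := (hub (p k), false).
have acceptsE T := NP (@Pointed (cover T) u) (undirC _ (cover_undirected T)).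
have := acceptsE S; have := acceptsE S'.
(* The DHN rejects the hub in the cover of [S] and accepts it in that of [S']. *)
rewrite !(@triangle_dhn_hub R special _ _ _ _ (specialE k)) -surjective_pairing ijS ijS'.
suff -> : gnn_accepts N (@Pointed (cover S) u) = gnn_accepts N (@Pointed (cover S') u).
  by move=> [_ /(_ isT) acc] [/(_ acc)].
apply: gnn_accepts_double_cover => m x.
have tE T := tP m (@Pointed (cover T) (x, false)).
exact: etrans (esym (tE S)) (etrans (eq_count (t m) x (lt_tk m)) (tE S')).
Qed.

Theorem theorem13 (R : realType) :
  (dhn_strictly_more_expressive R undirected 0 /\
   dhn_strictly_more_expressive R directed 0) /\
  (dhn_strictly_more_expressive R undirected 1 /\
   dhn_strictly_more_expressive R directed 1).
Proof.
have strict (C : graph -> Prop) d : (forall G, undirected G -> C G) ->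
    dhn_strictly_more_expressive R C d.
  move=> undirC; split=> [P|]; first exact: dhn_expressible_of_gnn.
  have [N N_not_gnn] := dhn_not_gnn R d.
  exists (dhn_accepts N); split; last exact: N_not_gnn.
  by exists N.
by split; split; apply: strict.
Qed.
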